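(* Let $\mathcal{T}$ be a knowledge tree with super root $\lambda$ and let $\alpha\neq\lambda$ be a node of $\mathcal{T}$. Let $S_\alpha$ be the set of all fragments of $\alpha$, and let $$\mathcal{K}_\alpha^{\mathcal{T}}=\sum_{\alpha_i\in S_\alpha}-\frac{V_{\alpha_i}}{W}\log_2\frac{V_{\alpha_i}}{V_{\alpha_i^-}}$$ be the KQI of $\alpha$, where $V_{\alpha_i}$ is the volume of the fragment $\alpha_i$ and $\alpha_i^-$ is the parent fragment of $\alpha_i$. Then $$\mathcal{K}_\alpha^{\mathcal{T}}=-\sum_{1\le i\le d_\alpha^{in}}\frac{V_\alpha^{\mathcal{T}}}{d_\alpha^{in}W}\log_2\frac{V_\alpha^{\mathcal{T}}}{d_\alpha^{in}V_{\alpha_i^-}^{\mathcal{T}}},$$ where on the right-hand side $\alpha_i^-$ denotes the $i$-th parent of $\alpha$ in $\mathcal{T}$, and $V^{\mathcal{T}}$ is defined recursively for all nodes $\beta$ of $\mathcal{T}$ by $$V_\beta^{\mathcal{T}}=d_\beta^{out}+\sum_{1\le i\le d_\beta^{out}}\frac{V_{\beta_i^+}^{\mathcal{T}}}{d_{\beta_i^+}^{in}},$$ with $\beta_i^+$ the $i$-th child of $\beta$.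
   Context: Knowledge tree (multiple-inherited): start from a finite directed acyclic graph with $n\ge1$ source nodes; for each non-source node select a nonempty set of its in-neighbours (parents) and keep only the edges from selected parents; add a super root node $\lambda$ with an edge to each of the $n$ source nodes. The result $\mathcal{T}$ is a finite simple directed acyclic graph with unique source $\lambda$ (it need not be a tree). For a node $v$, $d_v^{in}$ and $d_v^{out}$ are its in-degree and out-degree in $\mathcal{T}$; the parents and children of $v$ are its in-neighbours and out-neighbours. $W=\sum_v d_v^{out}$ is the graph size. Fragments: $\mathcal{T}$ is decomposed into an actual tree by splitting every node, together with everything descending from it, into equal parts, one per parent, from the leaves up to the root. Concretely, the fragments of a node $\alpha$ correspond to the directed paths $\pi=(\lambda=v_0,v_1,\dots,v_k=\alpha)$ from the super root to $\alpha$; the share of the node carried by the fragment $\pi$ is $\omega(\pi)=\prod_{i=1}^{k}\frac{1}{d_{v_i}^{in}}$ (with $\omega=1$ for the trivial path at $\lambda$). The parent fragment of $\pi$ (for $k\ge1$) is $(v_0,\dots,v_{k-1})$; this makes the fragments the nodes of a rooted tree. The volume of the fragment $\pi$ is the total out-degree of the community it represents, i.e. the sum, over all fragments $\sigma$ that are equal to $\pi$ or descend from it in this tree (paths $\sigma$ having $\pi$ as initial segment), of $\omega(\sigma)\,d^{out}_{\mathrm{end}(\sigma)}$, where $\mathrm{end}(\sigma)$ is the last node of $\sigma$. The convention $0\log_2 0=0$ is used. *)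

(* Defs.v *)
From HB Require Import structures.
From mathcomp Require Import all_boot all_order all_algebra.
From mathcomp Require Import reals exp.

Set Implicit Arguments.
Unset Strict Implicit.
Unset Printing Implicit Defensive.

Import Order.TTheory GRing.Theory Num.Theory.

(* [cycle e c] says that [c] is a closed walk; one-vertex walks are included,
   so loops are excluded as well. *)
Definition acyclic (T : finType) (e : rel T) : Prop :=
  forall c : seq T, cycle e c -> c = [::].

Definition is_source (T : finType) (e : rel T) : pred T :=
  fun v => [forall u, ~~ e u v].

(* The data a knowledge tree is built from: a finite directed acyclic graph
   with n >= 1 sources and, for each non-source vertex, a nonempty set of
   selected in-neighbours. (For a source, [parentsP] forces the empty set.) *)
Record knowledge_tree := KnowledgeTree {
  vertex : finType;
  arc : rel vertex;
  arc_acyclic : acyclic arc;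
  source_gt0 : (0 < #|[set v | is_source arc v]|)%N;
  parents : vertex -> {set vertex};
  parentsP : forall v, parents v \subset [set u | arc u v];
  parents_neq0 : forall v, ~~ is_source arc v -> parents v != set0
}.

(* The nodes are the vertices together with the super root [None]. *)
Definition node (K : knowledge_tree) : finType := option (vertex K).

Definition super_root (K : knowledge_tree) : node K := None.

Definition edge (K : knowledge_tree) : rel (node K) :=
  fun u v => match u, v with
             | None, Some v' => is_source (@arc K) v'
             | Some u', Some v' => u' \in parents v'
             | _, None => false
             end.

Definition indeg (K : knowledge_tree) (v : node K) : nat :=
  #|[set u | edge u v]|.

Definition outdeg (K : knowledge_tree) (v : node K) : nat :=
  #|[set w | edge v w]|.

(* Directed walks are simple and hence bounded in length: this is what makes
   the type of fragments finite and the recursion on children terminate. *)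
Lemma path_edge_Some (K : knowledge_tree) (v : vertex K) (p : seq (node K)) :
  path (@edge K) (Some v) p ->
  exists2 q : seq (vertex K), p = map Some q & path (@arc K) v q.
Proof.
elim: p v => [|[w|] p IHp] v //=; first by exists [::].
case/andP=> vw /IHp[q -> wq]; exists (w :: q) => //=.
by rewrite wq andbT; have /subsetP/(_ _ vw) := parentsP w; rewrite inE.
Qed.

Lemma arc_path_uniq (K : knowledge_tree) (v : vertex K) (q : seq (vertex K)) :
  path (@arc K) v q -> uniq (v :: q).
Proof.
elim: q v => [|w q IHq] v // /[dup] vq /andP[_ /IHq wq].
rewrite cons_uniq wq andbT; apply/negP => /splitPr vin.
case: vin vq => q1 q2; rewrite cat_path /= => /and3P[vq1 lastv _].
have := @arc_acyclic K (v :: q1).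
by rewrite /= rcons_path vq1 lastv => /(_ isT).
Qed.

Lemma edge_path_uniq (K : knowledge_tree) (u : node K) (p : seq (node K)) :
  path (@edge K) u p -> uniq (u :: p).
Proof.
have SomeU v q : path (@edge K) (Some v) q -> uniq (Some v :: q).
  case/path_edge_Some=> q' -> /arc_path_uniq uq.
  by rewrite -map_cons map_inj_uniq // => x y [].
case: u => [v|]; first exact: SomeU.
case: p => [|[v|] p] // /andP[_ vp].
rewrite cons_uniq SomeU // andbT inE.
by have [q -> _] := path_edge_Some vp; elim: q.
Qed.

Lemma edge_path_size (K : knowledge_tree) (u : node K) (p : seq (node K)) :
  path (@edge K) u p -> (size p < #|node K|)%N.
Proof. by move/edge_path_uniq/card_uniqP=> /= <-; apply: max_card. Qed.

(* The fragment (v_0 = super root, v_1, ..., v_k) is represented by the sequence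
   v_1, ..., v_k; the initial super root is implicit. *)
Definition fragment (K : knowledge_tree) : predArgType :=
  {p : seq (node K) | path (@edge K) (super_root K) p}.

HB.instance Definition _ (K : knowledge_tree) :=
  SubCountable.on (fragment K).

Definition fragment_bseq (K : knowledge_tree) (pi : fragment K) :
    #|node K|.-bseq (node K) :=
  Bseq (ltnW (edge_path_size (valP pi))).

Definition bseq_fragment (K : knowledge_tree) (s : #|node K|.-bseq (node K)) :
    option (fragment K) :=
  insub (val s).

Lemma fragment_bseqK (K : knowledge_tree) :
  pcancel (@fragment_bseq K) (@bseq_fragment K).
Proof. by move=> pi; rewrite /bseq_fragment valK. Qed.

HB.instance Definition _ (K : knowledge_tree) : isFinite (fragment K) :=
  PCanIsFinite (@fragment_bseqK K).

Definition fragment_end (K : knowledge_tree) (pi : fragment K) : node K :=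
  last (super_root K) (val pi).

Definition fragments_of (K : knowledge_tree) (a : node K) :
    {set fragment K} :=
  [set pi | fragment_end pi == a].

(* On the trivial fragment, which has no parent, this returns the trivial
   fragment itself. *)
Definition parent_fragment (K : knowledge_tree) (pi : fragment K) :
    fragment K :=
  exist _ (take (size (val pi)).-1 (val pi)) (take_path _ (valP pi)).

Local Open Scope ring_scope.

Definition log2 (R : realType) (x : R) : R := ln x / ln 2.

Definition graph_size (R : realType) (K : knowledge_tree) : R :=
  \sum_(v : node K) (outdeg v)%:R.

Definition share (R : realType) (K : knowledge_tree) (pi : fragment K) : R :=
  \prod_(v <- val pi) (1 / (indeg v)%:R).

Definition fragment_volume (R : realType) (K : knowledge_tree)
    (pi : fragment K) : R :=
  \sum_(sigma : fragment K | prefix (val pi) (val sigma))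
    share R sigma * (outdeg (fragment_end sigma))%:R.

(* If the volume of a fragment is 0, the summand is 0 * log2 0 = 0. *)
Definition KQI (R : realType) (K : knowledge_tree) (a : node K) : R :=
  \sum_(pi in fragments_of a)
    - (fragment_volume R pi / graph_size R K)
      * log2 (fragment_volume R pi / fragment_volume R (parent_fragment pi)).

Fixpoint node_volume_rec (R : realType) (K : knowledge_tree) (n : nat)
    (b : node K) : R :=
  if n is n'.+1 then
    (outdeg b)%:R
    + \sum_(c : node K | edge b c) node_volume_rec R n' c / (indeg c)%:R
  else 0.

(* The recursive volume; the fuel is never exhausted, as [node_volumeE] shows,
   which is the defining recursion. *)
Definition node_volume (R : realType) (K : knowledge_tree) (b : node K) : R :=
  node_volume_rec R #|node K| b.

Lemma node_volume_recS (R : realType) (K : knowledge_tree) (n : nat)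
    (b : node K) :
  (forall p, path (@edge K) b p -> (size p < n)%N) ->
  node_volume_rec R n b = node_volume_rec R n.+1 b.
Proof.
elim: n b => [|n IHn] b short; first by have := short [::] isT.
rewrite [RHS]/= -/(node_volume_rec R n.+1) [LHS]/=; congr (_ + _).
apply: eq_bigr => c bc; rewrite IHn // => p cp.
by have := short (c :: p); rewrite /= bc => /(_ cp).
Qed.

Lemma node_volumeE (R : realType) (K : knowledge_tree) (b : node K) :
  node_volume R b =
    (outdeg b)%:R + \sum_(c : node K | edge b c) node_volume R c / (indeg c)%:R.
Proof.
by rewrite {1}/node_volume node_volume_recS // => p; apply: edge_path_size.
Qed.

(* Main.v *)
(* A fragment [pi] of [a] carries the fraction [share pi] of the whole community
   of [a], so its volume is [share pi * node_volume a]. A fragment of [a] other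
   than the trivial one is a fragment [rho] of some parent [b] of [a] followed
   by [a], with share [share rho / indeg a]; the share cancels in the ratio of
   volumes, so the logarithm depends on [b] only, and the fragments of [b]
   contribute their total share, which is 1. *)
Require Import Defs.
From mathcomp Require Import all_boot all_order all_algebra.
From mathcomp Require Import reals exp.

Set Implicit Arguments.
Unset Strict Implicit.
Unset Printing Implicit Defensive.

Import GRing.Theory Num.Theory.

Local Open Scope ring_scope.

Lemma indeg_gt0 (K : knowledge_tree) (u v : node K) :
  edge u v -> (0 < indeg v)%N.
Proof. by move=> uv; apply/card_gt0P; exists u; rewrite inE. Qed.

Lemma indeg_nonroot_gt0 (K : knowledge_tree) (v : node K) :
  v != super_root K -> (0 < indeg v)%N.
Proof.
case: v => // v _; case: (boolP (is_source (@Defs.arc K) v)) => [vsrc|].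
  exact: (@indeg_gt0 _ None).
by move=> /parents_neq0/set0Pn[u uv]; apply: (@indeg_gt0 _ (Some u)).
Qed.

(* Only meaningful when there is an edge from the end of [rho] to [a]; otherwise
   it returns [rho]. *)
Definition extend_fragment (K : knowledge_tree) (rho : fragment K)
    (a : node K) : fragment K :=
  insubd rho (rcons (val rho) a).

Lemma val_extend_fragment (K : knowledge_tree) (rho : fragment K) (a : node K) :
  edge (fragment_end rho) a -> val (extend_fragment rho a) = rcons (val rho) a.
Proof.
by move=> ra; rewrite val_insubd rcons_path (valP rho) -/(fragment_end rho) ra.
Qed.

Lemma fragment_end_extend (K : knowledge_tree) (rho : fragment K) (a : node K) :
  edge (fragment_end rho) a -> fragment_end (extend_fragment rho a) = a.
Proof.
by move=> ra; rewrite {1}/fragment_end val_extend_fragment // last_rcons.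
Qed.

Lemma parent_fragment_extend (K : knowledge_tree) (rho : fragment K)
    (a : node K) :
  edge (fragment_end rho) a -> parent_fragment (extend_fragment rho a) = rho.
Proof.
move=> ra; apply: val_inj.
by rewrite /= val_extend_fragment // size_rcons /= -cats1 take_size_cat.
Qed.

Lemma extend_parent_fragment (K : knowledge_tree) (pi : fragment K) :
  fragment_end pi != super_root K ->
  edge (fragment_end (parent_fragment pi)) (fragment_end pi) /\
  extend_fragment (parent_fragment pi) (fragment_end pi) = pi.
Proof.
case: pi => p pP; rewrite /fragment_end /=.
case/lastP: p pP => [|p a] pP; first by rewrite eqxx.
move=> _; rewrite last_rcons size_rcons /=.
have def_p : take (size p) (rcons p a) = p by rewrite -cats1 take_size_cat.
have pa : edge (last (super_root K) p) a.
  by move: pP; rewrite rcons_path => /andP[].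
rewrite def_p; split=> //; apply: val_inj; rewrite val_extend_fragment /=.
  by rewrite size_rcons /= def_p.
by rewrite /fragment_end /= size_rcons /= def_p.
Qed.

(** Deleting the last node of a nontrivial fragment and appending it again are mutually inverse, so
    the fragments of [a] correspond to those of its parents. *)
Lemma big_fragments_of (R : nmodType) (K : knowledge_tree) (a : node K)
    (F : fragment K -> R) : a != super_root K ->
  \sum_(pi in fragments_of a) F pi =
  \sum_(b | edge b a) \sum_(rho in fragments_of b) F (extend_fragment rho a).
Proof.
move=> a_neq0.
rewrite (reindex_onto (fun rho => extend_fragment rho a) (@parent_fragment K)).
  rewrite (partition_big (@fragment_end K) (fun b => edge b a)) => [|rho].
    apply: eq_bigr => b ba; apply: eq_bigl => rho; rewrite !inE.
    case: (fragment_end rho =P b) => [rhob|]; last by rewrite andbF.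
    rewrite -rhob in ba.
    by rewrite fragment_end_extend // parent_fragment_extend // !eqxx.
  (* The reindexing conditions exclude the fallback value of [extend_fragment]: they make [rho] the
     parent of a fragment ending at [a], which yields the edge into [a]. *)
  rewrite inE => /andP[/eqP enda /eqP par].
  have [] := @extend_parent_fragment _ (extend_fragment rho a).
    by rewrite enda.
  by rewrite enda par.
move=> pi; rewrite inE => /eqP enda.
by have [] := @extend_parent_fragment _ pi; rewrite enda.
Qed.

Lemma share_extend (R : realType) (K : knowledge_tree) (rho : fragment K)
    (a : node K) : edge (fragment_end rho) a ->
  share R (extend_fragment rho a) = share R rho / (indeg a)%:R.
Proof.
move=> ra; rewrite /share val_extend_fragment // -cats1 big_cat big_seq1 /=.
by rewrite div1r.
Qed.

(** Every node on a fragment is entered by an edge, so no in-degree in the product vanishes. This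
    permits cancelling the share in a ratio of volumes. *)
Lemma share_neq0 (R : realType) (K : knowledge_tree) (pi : fragment K) :
  share R pi != 0.
Proof.
rewrite /share; case: pi => p /=.
elim: p (super_root K) => [|v p IHp] u /=; first by rewrite big_nil oner_neq0.
case/andP=> uv /IHp vp; rewrite big_cons mulf_neq0 // div1r invr_eq0.
by rewrite pnatr_eq0 -lt0n (indeg_gt0 uv).
Qed.

Lemma fragments_of_root (K : knowledge_tree) (pi : fragment K) :
  (pi \in fragments_of (super_root K)) = nilp (val pi).
Proof.
rewrite inE /fragment_end; case: pi => p /=; case/lastP: p => [|p a] //=.
rewrite rcons_path last_rcons /nilp size_rcons => /andP[_].
by case: a => //; case: (last _ _).
Qed.

(** Induction on a strict bound [n] for the lengths of walks ending at [a]; it drops for a parent,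
    since a walk to the parent extends to [a]. Each of the [indeg a] parents passes on a total share
    of [1 / indeg a]. *)
Lemma sum_share (R : realType) (K : knowledge_tree) (a : node K) :
  \sum_(pi in fragments_of a) share R pi = 1.
Proof.
have [n short] : exists n, forall u p,
    path (@edge K) u p -> last u p = a -> (size p < n)%N.
  by exists #|node K| => u p /edge_path_size.
elim: n a short => [|n IHn] a short; first by have := short a [::] isT erefl.
have [->|a_neq0] := eqVneq a (super_root K).
  have nilP : path (@edge K) (super_root K) [::] by [].
  rewrite (big_pred1 (exist _ [::] nilP : fragment K)) /share /= ?big_nil // => pi.
  by rewrite fragments_of_root /= -val_eqE /=; case: (val pi).
rewrite big_fragments_of //.
under eq_bigr => b ba.
  under eq_bigr => rho.
    rewrite inE => /eqP endb; rewrite share_extend ?endb //; over.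
  rewrite -mulr_suml IHn => [|u p up endb]; first over.
  by have := short u (rcons p a); rewrite rcons_path up endb ba last_rcons
    size_rcons; apply.
rewrite big_const iter_addr_0 mul1r -[RHS](@mulVf _ (indeg a)%:R).
  by rewrite mulr_natr /indeg cardsE.
by rewrite pnatr_eq0 -lt0n indeg_nonroot_gt0.
Qed.

(** Besides [pi] itself, the fragments below [pi] are sorted by the node that follows [pi] in
    them. *)
Lemma fragment_volume_rec (R : realType) (K : knowledge_tree)
    (pi : fragment K) :
  fragment_volume R pi =
  share R pi * (outdeg (fragment_end pi))%:R +
  \sum_(c | edge (fragment_end pi) c) fragment_volume R (extend_fragment pi c).
Proof.
rewrite {1}/fragment_volume (bigD1 pi) ?prefix_refl //=; congr (_ + _).
(* The default of [nth] is never reached on the fragments being summed, which are strictly longer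
   than [pi]. *)
pose next (sigma : fragment K) := nth (super_root K) (val sigma) (size (val pi)).
rewrite (partition_big next (edge (fragment_end pi))) => [|sigma].
  apply: eq_bigr => c pc; apply: eq_bigl => sigma.
  rewrite val_extend_fragment // /next -val_eqE /=.
  apply/idP/idP => [/andP[/andP[/prefixP[s ->]]]|/prefixP[s ->]].
    case: s => [|d s]; first by rewrite cats0 eqxx.
    rewrite nth_cat ltnn subnn /= => _ /eqP ->.
    by rewrite -cat_rcons prefix_prefix.
  (* Conversely, cancelling the common prefix [val pi] reduces [sigma != pi] to [c :: s != [::]]. *)
  rewrite cat_rcons prefix_prefix nth_cat ltnn subnn /= eqxx andbT.
  by rewrite -[X in _ != X]cats0 eqseq_cat // eqxx.
rewrite /next -val_eqE /= => /andP[/prefixP[[|d s] def_s]].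
  by rewrite def_s cats0 eqxx.
have := valP sigma; rewrite /= def_s cat_path nth_cat ltnn subnn /=.
by case/and3P.
Qed.

(** Both sides obey the same recursion over children, as appending [c] divides the share by
    [indeg c]. The induction is on a bound for walks leaving the end of [pi]. *)
Lemma fragment_volumeE (R : realType) (K : knowledge_tree) (pi : fragment K) :
  fragment_volume R pi = share R pi * node_volume R (fragment_end pi).
Proof.
have [n short] : exists n, forall p,
    path (@edge K) (fragment_end pi) p -> (size p < n)%N.
  by exists #|node K| => p /edge_path_size.
elim: n pi short => [|n IHn] pi short; first by have := short [::] isT.
rewrite fragment_volume_rec node_volumeE mulrDr mulr_sumr; congr (_ + _).
apply: eq_bigr => c pc; rewrite IHn => [|p].
  by rewrite share_extend // fragment_end_extend // mulrAC mulrA.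
rewrite fragment_end_extend // => cp.
by have := short (c :: p); rewrite /= pc => /(_ cp).
Qed.

Theorem theorem3p2 (R : realType) (K : knowledge_tree) (alpha : node K)
    (alpha_neq_root : alpha != super_root K) :
  KQI R alpha =
    - \sum_(b : node K | edge b alpha)
        node_volume R alpha / ((indeg alpha)%:R * graph_size R K)
        * log2 (node_volume R alpha / ((indeg alpha)%:R * node_volume R b)).
Proof.
rewrite /KQI big_fragments_of // -sumrN; apply: eq_bigr => b b_alpha.
set v := node_volume R alpha; set d := (indeg alpha)%:R.
set W := graph_size R K; set l := log2 _.
under eq_bigr => rho.
  rewrite inE => /eqP endb; have rho_alpha : edge (fragment_end rho) alpha.
    by rewrite endb.
  rewrite parent_fragment_extend // !fragment_volumeE fragment_end_extend //.
  rewrite share_extend // endb -/v -/d.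
  have -> : share R rho / d * v / (share R rho * node_volume R b) =
            v / (d * node_volume R b).
    rewrite -[_ / d * v]mulrA -mulf_div divff ?share_neq0 // mul1r.
    by rewrite [d^-1 * v]mulrC invfM mulrA.
  rewrite -/l mulNr -!mulrA -mulrN; over.
rewrite -mulr_suml sum_share mul1r invfM !mulrA.
by rewrite [_^-1 * v]mulrC.
Qed.
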